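(* Let $n \geq 2$, let $K \subseteq \mathbb{R}^n$ be a Kakeya set, and let $A$ be the collection of all the midpoints of the unit line segments contained in $K$. Let $s$ be a real number. Then: (1) if $\overline{\dim}_{\mathrm{B}} A \leq s$, then $\underline{\dim}_{\mathrm{B}} K \geq n-s$; (2) if $\dim_{\mathrm{P}} A \leq s$, then $\dim_{\mathrm{H}} K \geq n-s$.
   Context: For $e \in S^{n-1}$ and $a\in\mathbb{R}^n$, let $I_e(a) = \{a + t e : -1/2 \leq t \leq 1/2\}$ be the unit line segment in direction $e$ with midpoint $a$. A Kakeya set in $\mathbb{R}^n$ is a compact set $K \subseteq \mathbb{R}^n$ such that for every $e \in S^{n-1}$ there is $a_e \in \mathbb{R}^n$ with $I_e(a_e) \subseteq K$. $\dim_{\mathrm{H}}$ is Hausdorff dimension. For bounded $E \subseteq \mathbb{R}^n$ and $\delta>0$, $N_\delta(E)$ is the smallest number of sets of diameter at most $\delta$ needed to cover $E$; $\underline{\dim}_{\mathrm{B}} E = \liminf_{\delta\to 0} \frac{\log N_\delta(E)}{-\log\delta}$ and $\overline{\dim}_{\mathrm{B}} E = \limsup_{\delta\to 0} \frac{\log N_\delta(E)}{-\log\delta}$ are the lower and upper box-counting dimensions. The packing dimension is $\dim_{\mathrm{P}} E = \inf\{\sup_i \overline{\dim}_{\mathrm{B}} E_i : E \subseteq \bigcup_{i=1}^\infty E_i\}$ (with $E_i$ bounded). *)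

(* Defs.v *)
From mathcomp Require Import all_boot all_order all_algebra.
From mathcomp Require Import all_classical all_reals all_analysis.

Set Implicit Arguments.
Unset Strict Implicit.
Unset Printing Implicit Defensive.

Import Order.TTheory GRing.Theory Num.Theory.
Import numFieldNormedType.Exports.

Local Open Scope classical_set_scope.
Local Open Scope ring_scope.

(* R^n is 'rV[R]_n. The norm `|x| that the library puts on it is the sup norm,
   so the Euclidean norm, used for directions and diameters, is defined here.
   Both norms give the same topology, hence the same compact sets and the same
   bounded sets, for which the library notions are used. *)
Definition eucl_norm (R : realType) (n : nat) (x : 'rV[R]_n) : R :=
  Num.sqrt (\sum_(i < n) x ord0 i ^+ 2).

Definition unit_sphere (R : realType) (n : nat) : set 'rV[R]_n :=
  [set e | eucl_norm e = 1].

Definition unit_segment (R : realType) (n : nat) (e a : 'rV[R]_n) :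
    set 'rV[R]_n :=
  [set a + t *: e | t in [set t : R | - (1 / 2) <= t <= 1 / 2]].

Definition kakeya_set (R : realType) (n : nat) (K : set 'rV[R]_n) : Prop :=
  compact K /\
  forall e, unit_sphere e -> exists a, unit_segment e a `<=` K.

Definition midpoints (R : realType) (n : nat) (K : set 'rV[R]_n) :
    set 'rV[R]_n :=
  [set a | exists2 e, unit_sphere e & unit_segment e a `<=` K].

Local Open Scope ereal_scope.

(* 0 is adjoined to the set of distances only to make the diameter of the
   empty set equal to 0 rather than -oo. *)
Definition diameter (R : realType) (n : nat) (U : set 'rV[R]_n) : \bar R :=
  ereal_sup (0 |` [set d | exists x y,
    [/\ U x, U y & d = (eucl_norm (x - y)%R)%:E]]).

(* +oo when E has no finite cover, which does not happen for bounded E. *)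
Definition covering_number (R : realType) (n : nat) (delta : R)
    (E : set 'rV[R]_n) : \bar R :=
  ereal_inf [set (m%:R : R)%:E | m in [set m : nat |
    exists U : 'I_m -> set 'rV[R]_n,
      (forall i, diameter (U i) <= delta%:E) /\
      E `<=` \bigcup_(i in [set: 'I_m]) U i]].

Definition box_ratio (R : realType) (n : nat) (E : set 'rV[R]_n) (delta : R) :
    \bar R :=
  lne (covering_number delta E) * ((- ln delta)^-1)%:E.

(* 0^'+ is the filter of the deleted right neighbourhoods of 0. The box
   dimensions of the empty set are -oo, as lne 0 = -oo. *)
Definition lower_box_dim (R : realType) (n : nat) (E : set 'rV[R]_n) : \bar R :=
  limf_einf (box_ratio E) (0 : R)^'+.

Definition upper_box_dim (R : realType) (n : nat) (E : set 'rV[R]_n) : \bar R :=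
  limf_esup (box_ratio E) (0 : R)^'+.

Definition packing_dim (R : realType) (n : nat) (E : set 'rV[R]_n) : \bar R :=
  ereal_inf [set ereal_sup (range (fun i => upper_box_dim (F i))) |
    F in [set F : nat -> set 'rV[R]_n |
      (forall i, bounded_set (F i)) /\ E `<=` \bigcup_i F i]].

(* The s-th power of the diameter; the empty set contributes 0 for every s,
   including s = 0, where a nonempty set contributes 1 (0 `^ 0 = 1). *)
Definition diameter_pow (R : realType) (n : nat) (s : R) (U : set 'rV[R]_n) :
    \bar R :=
  if U == set0 then 0 else diameter U `^ s.

Definition hausdorff_premeasure (R : realType) (n : nat) (s delta : R)
    (E : set 'rV[R]_n) : \bar R :=
  ereal_inf [set \sum_(0 <= i <oo) diameter_pow s (U i) |
    U in [set U : nat -> set 'rV[R]_n |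
      (forall i, diameter (U i) <= delta%:E) /\ E `<=` \bigcup_i U i]].

Definition hausdorff_measure (R : realType) (n : nat) (s : R)
    (E : set 'rV[R]_n) : \bar R :=
  ereal_sup [set hausdorff_premeasure s delta E |
    delta in [set delta : R | (0 < delta)%R]].

Definition hausdorff_dim (R : realType) (n : nat) (E : set 'rV[R]_n) : \bar R :=
  ereal_inf [set s%:E | s in [set s : R |
    (0 <= s)%R /\ hausdorff_measure s E = 0]].

(* Main.v *)
(* Every x with |x| <= 1/2 is t e for a direction e and some |t| <= 1/2, hence
   x = (a_e + t e) - a_e, and so a cube of side l = 1/(2n) lies in K - A.
   If K is covered by sets U_i of diameter at most d_i, and A by fewer than
   d_i^-t sets V_ik of diameter at most d_i for each i, then the differences
   U_i - V_ik lie in boxes of size comparable to d_i that cover this cube, so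
   that sum_i d_i^(n-t) is bounded below. With all d_i equal this bounds the
   covering numbers of K. For the Hausdorff dimension, a piece F_j of A of upper
   box dimension less than t has such covers at all small scales; if K had
   measure 0 in dimension less than n - t, the sum could be made arbitrarily
   small, even summed over countably many pieces. *)
Require Import Defs.
From mathcomp Require Import all_boot all_order all_algebra.
From mathcomp Require Import all_classical all_reals all_analysis.
From mathcomp Require Import ring lra.

Set Implicit Arguments.
Unset Strict Implicit.
Unset Printing Implicit Defensive.

Import Order.TTheory GRing.Theory Num.Theory.
Import numFieldNormedType.Exports.

Local Open Scope classical_set_scope.
Local Open Scope ring_scope.

(** * Volume bound for covers of a cube, by counting grid points *)

(** The indices lie between a least [a] and a greatest [b] whose multiples of [h] are less than
    [2 * r] apart; counting both ends adds one more [h], which is at most [2 * r]. *)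
Lemma card_grid_interval (R : realType) (N : nat) (h c r : R) :
  0 < h -> h <= 2 * r ->
  #|[set k : 'I_N | `|k%:R * h - c| < r]%SET|%:R * h <= 4 * r.
Proof.
move=> h0 hr; set S := [set k | _]%SET.
have [->|[k0 k0S]] := set_0Vmem S; first by rewrite cards0 mul0r; lra.
pose a := [arg min_(k < k0 | k \in S) (k : nat)].
pose b := [arg max_(k > k0 | k \in S) (k : nat)].
have [aS amin] : a \in S /\ forall k, k \in S -> (a <= k)%N.
  by rewrite /a; case: arg_minnP.
have [bS bmax] : b \in S /\ forall k, k \in S -> (k <= b)%N.
  by rewrite /b; case: arg_maxnP.
have ab : (a <= b)%N := amin _ bS.
have Sab : (#|S| <= (b - a).+1)%N.
  rewrite cardE -(size_map val) -(size_iota a (b - a).+1).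
  apply: uniq_leq_size; first by rewrite map_inj_uniq ?enum_uniq//; exact: val_inj.
  move=> _ /mapP[k + ->]; rewrite mem_enum mem_iota => kS.
  by rewrite amin//= addnS subnKC// ltnS bmax.
have : #|S|%:R <= (b%:R - a%:R + 1 : R).
  by rewrite -natrB// natr1 ler_nat.
move: aS bS; rewrite !inE !ltr_norml => /andP[a1 a2] /andP[b1 b2].
move=> /(ler_wpM2r (ltW h0)); lra.
Qed.

(** For [0 < r] this is the open ball of the sup norm, written by coordinates so that counting grid
    points in it factors. *)
Definition box (R : realType) (n : nat) (c : 'rV[R]_n) (r : R) : set 'rV[R]_n :=
  [set x | forall i, `|x ord0 i - c ord0 i| < r].

Definition cube (R : realType) (n : nat) (l : R) : set 'rV[R]_n :=
  [set x | forall i, 0 <= x ord0 i <= l].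

Lemma card_grid_box (R : realType) (n N : nat) (h r : R) (c : 'rV[R]_n) :
  0 < h -> h <= 2 * r ->
  #|[set g : {ffun 'I_n -> 'I_N} |
     [forall i, `|(g i)%:R * h - c ord0 i| < r]]%SET|%:R * h ^+ n
  <= (4 * r) ^+ n.
Proof.
move=> h0 hr.
pose S i := [set k : 'I_N | `|k%:R * h - c ord0 i| < r]%SET.
have -> : #|[set g : {ffun 'I_n -> 'I_N} |
     [forall i, `|(g i)%:R * h - c ord0 i| < r]]%SET| = (\prod_(i < n) #|S i|)%N.
  transitivity #|family (fun i => mem (S i))|.
    apply: eq_card => g; rewrite inE; apply/forallP/familyP => H i.
      by rewrite /= /S inE.
    by have := H i; rewrite /= /S inE.
  by rewrite card_family foldrE big_map big_enum.
have E (y : R) : y ^+ n = \prod_(i < n) y by rewrite prodr_const card_ord.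
rewrite natr_prod !E -big_split/=.
apply: ler_prod => i _; apply/andP; split; last exact: card_grid_interval.
by rewrite mulr_ge0// ltW.
Qed.

(** Grid points stand in for Lebesgue measure: each of the [N ^ n] points of a grid of mesh
    [h = l / N] lies in some box, and a box of radius [r i] holds at most [(4 * r i) ^ n / h ^ n] of
    them. *)
Lemma cube_cover_volume (R : realType) (n : nat) (l : R) (I : eqType)
    (s : seq I) (m : I -> nat) (r : I -> R)
    (c : forall i, 'I_(m i) -> 'rV[R]_n) :
  0 < l -> (forall i, 0 < r i) ->
  (forall x, cube l x -> exists2 i, i \in s & exists k, box (c i k) (r i) x) ->
  l ^+ n <= \sum_(i <- s) (m i)%:R * (4 * r i) ^+ n.
Proof.
move=> l0 r0 cov.
(* The mesh must suit [card_grid_box] for every radius; as [s] is finite, one [N] serves all. *)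
have [N N0 Nr] : exists2 N : nat, (0 < N)%N &
    forall i, i \in s -> l / N%:R <= 2 * r i.
  elim: s {cov} => [|i s [N N0 IH]]; first by exists 1%N.
  exists (maxn N (Num.bound (l / (2 * r i)))); first by rewrite leq_max N0.
  have M0 : 0 < (maxn N (Num.bound (l / (2 * r i))))%:R :> R.
    by rewrite ltr0n leq_max N0.
  move=> j; rewrite in_cons => /predU1P[->|js].
    rewrite ler_pdivrMr// mulrC -ler_pdivrMr ?mulr_gt0//.
    apply: (le_trans (ltW (archi_boundP _))); first by rewrite divr_ge0 ?mulr_ge0 ?ltW.
    by rewrite ler_nat leq_maxr.
  apply: le_trans (IH _ js); rewrite ler_pM2l// lef_pV2 ?posrE//; last by rewrite ltr0n.
  by rewrite ler_nat leq_maxl.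
set h := l / N%:R in Nr.
have NR0 : 0 < N%:R :> R by rewrite ltr0n.
have h0 : 0 < h by rewrite divr_gt0.
pose G := {ffun 'I_n -> 'I_N}.
pose S i k := [set g : G | [forall j, `|(g j)%:R * h - c i k ord0 j| < r i]]%SET.
(* Double counting of pairs of a grid point and a box around it: every point has at least one. *)
have Gle : (N ^ n <= \sum_(i <- s) \sum_(k < m i) #|S i k|)%N.
  have -> : (N ^ n = \sum_(g : G) 1)%N by rewrite sum1_card card_ffun !card_ord.
  have -> : (\sum_(i <- s) \sum_(k < m i) #|S i k| =
      \sum_(g : G) \sum_(i <- s) \sum_(k < m i) (g \in S i k))%N.
    rewrite exchange_big/=; apply: eq_bigr => i _.
    rewrite exchange_big/=; apply: eq_bigr => k _.
    by rewrite -sum1_card big_mkcond.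
  apply: leq_sum => g _.
  pose x : 'rV[R]_n := \row_j ((g j)%:R * h).
  have [|i si [k xk]] := cov x.
    move=> j; rewrite mxE; apply/andP; split; first by rewrite mulr_ge0// ltW.
    rewrite /h mulrA ler_pdivrMr// mulrC ler_pM2l//.
    by rewrite ler_nat ltnW.
  rewrite (big_rem i)//= (bigD1 k)//= (_ : g \in S i k) ?addSn//.
  by rewrite inE; apply/forallP => j; have := xk j; rewrite mxE.
have -> : l = N%:R * h by rewrite /h mulrCA mulfV ?mulr1// gt_eqF.
have hn0 : 0 < h ^+ n by rewrite exprn_gt0.
rewrite exprMn -natrX; apply: (@le_trans _ _
  ((\sum_(i <- s) \sum_(k < m i) #|S i k|)%N%:R * h ^+ n)).
  by rewrite ler_pM2r// ler_nat.
rewrite natr_sum mulr_suml big_seq [leRHS]big_seq.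
apply: ler_sum => i si.
rewrite natr_sum mulr_suml mulr_natl -[m i in leRHS]card_ord -sumr_const.
apply: ler_sum => k _; apply: card_grid_box => //; exact: Nr.
Qed.

(** * The Euclidean norm, and a cube of differences between points of K and midpoints *)

Lemma eucl_norm_ge_coord (R : realType) (n : nat) (x : 'rV[R]_n) (i : 'I_n) :
  `|x ord0 i| <= eucl_norm x.
Proof.
rewrite -sqrtr_sqr ler_wsqrtr// (bigD1 i)//= lerDl.
by apply: sumr_ge0 => j _; exact: sqr_ge0.
Qed.

Lemma eucl_normZ (R : realType) (n : nat) (a : R) (x : 'rV[R]_n) :
  eucl_norm (a *: x) = `|a| * eucl_norm x.
Proof.
rewrite /eucl_norm -sqrtr_sqr -sqrtrM ?sqr_ge0// mulr_sumr.
by congr Num.sqrt; apply: eq_bigr => i _; rewrite mxE exprMn.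
Qed.

(** The [n] squares add up to at most $n (1/(2n))^2 = (1/2)^2/n$. *)
Lemma eucl_norm_cube (R : realType) (n : nat) (x : 'rV[R]_n) :
  (0 < n)%N -> cube (1 / (2 * n%:R)) x -> eucl_norm x <= 1 / 2.
Proof.
move=> n0 xc; have n0R : 0 < n%:R :> R by rewrite ltr0n.
have n1R : 1 <= n%:R :> R by rewrite ler1n.
rewrite -(ger0_norm (_ : 0 <= 1 / 2 :> R)) ?divr_ge0// -sqrtr_sqr.
rewrite ler_wsqrtr//.
apply: (@le_trans _ _ (\sum_(i < n) (1 / (2 * n%:R)) ^+ 2)).
  apply: ler_sum => i _; have /andP[xi0 xil] := xc i.
  by rewrite ler_pXn2r// nnegrE (le_trans xi0).
rewrite sumr_const card_ord -[leLHS]mulr_natl.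
have -> : n%:R * (1 / (2 * n%:R)) ^+ 2 = (1 / 2) ^+ 2 / n%:R :> R.
  by field; rewrite gt_eqF.
by rewrite ler_pdivrMr// ler_peMr// sqr_ge0.
Qed.

Lemma kakeya_cube (R : realType) (n : nat) (K : set 'rV[R]_n) (x : 'rV[R]_n) :
  (0 < n)%N -> kakeya_set K -> cube (1 / (2 * n%:R)) x ->
  exists k a, [/\ K k, midpoints K a & x = k - a].
Proof.
move=> n0 [_ kK] xc.
have [e [e1 [t t2 ->]]] : exists e, unit_sphere e /\
    exists2 t, - (1 / 2) <= t <= 1 / 2 & x = t *: e.
  have := eucl_norm_cube n0 xc.
  (* The origin determines no direction, so a coordinate vector is taken with [t = 0]; any other [x]
     is normalized. *)
  have [x0 _|x0 x12] := eqVneq (eucl_norm x) 0.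
    have -> : x = 0.
      apply/rowP => i; rewrite mxE; apply/eqP; rewrite -normr_le0.
      by rewrite (le_trans (eucl_norm_ge_coord _ _))// x0.
    exists (delta_mx ord0 (Ordinal n0)); split; last first.
      by exists 0; [lra|rewrite scale0r].
    rewrite /unit_sphere /eucl_norm /= (bigD1 (Ordinal n0))//= big1 => [|i /negPf iN].
      by rewrite mxE !eqxx expr1n addr0 sqrtr1.
    by rewrite mxE iN andbF expr0n.
  exists ((eucl_norm x)^-1 *: x); split.
    by rewrite /unit_sphere/= eucl_normZ ger0_norm ?invr_ge0 ?sqrtr_ge0// mulVf.
  exists (eucl_norm x); last by rewrite scalerA mulfV// scale1r.
  by rewrite x12 andbT (@le_trans _ _ 0) ?sqrtr_ge0//; lra.
have [a aK] := kK _ e1.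
exists (a + t *: e), a; split; last by rewrite addrAC subrr add0r.
  by apply: aK; exists t.
by exists e.
Qed.

(** * Covers of difference sets by boxes *)

Lemma diameter_ge (R : realType) (n : nat) (U : set 'rV[R]_n) (d : R) x y :
  (diameter U <= d%:E)%E -> U x -> U y -> eucl_norm (x - y) <= d.
Proof.
move=> Ud Ux Uy; rewrite -lee_fin; apply: le_trans Ud.
by apply: ereal_sup_ubound; right; exists x, y.
Qed.

(** Differences stray from a fixed [u - v] by at most [2 * d] in each coordinate; the radius [3 * d]
    makes this strict, as an open box requires. *)
Lemma difference_box (R : realType) (n : nat) (U V : set 'rV[R]_n) (d : R) :
  0 < d -> (diameter U <= d%:E)%E -> (diameter V <= d%:E)%E ->
  exists c, forall x y, U x -> V y -> box c (3 * d) (x - y).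
Proof.
move=> d0 Ud Vd.
have [->|/set0P[u Uu]] := eqVneq U set0; first by exists 0.
have [->|/set0P[v Vv]] := eqVneq V set0; first by exists 0.
exists (u - v) => x y Ux Vy i.
have := le_trans (eucl_norm_ge_coord (x - u) i) (diameter_ge Ud Ux Uu).
have := le_trans (eucl_norm_ge_coord (y - v) i) (diameter_ge Vd Vy Vv).
rewrite !mxE !ler_norml ltr_norml => /andP[? ?] /andP[? ?]; lra.
Qed.

Lemma box_open (R : realType) (n : nat) (c : 'rV[R]_n) (r : R) :
  0 < r -> open (box c r).
Proof.
move=> r0; rewrite (_ : box c r = ball c r); first exact: ball_open.
apply/seteqP; split => [x xc|x [_ xc] i].
  by split=> // i j; rewrite (ord1 i); have := xc j; rewrite distrC.
by have := xc ord0 i; rewrite /ball/= distrC.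
Qed.

Lemma cube_compact (R : realType) (n : nat) (l : R) : compact (@cube R n l).
Proof.
have := @rV_compact R n (fun=> `[0, l]%classic) (fun=> @segment_compact _ _ _).
by congr compact; apply/seteqP; split => x xc i; have := xc i; rewrite /= in_itv.
Qed.

(** Compactness reduces an infinite family to a finite one. The boxes of one index [i] are merged
    into a single open set, so that the finite subcover is a list of indices. *)
Lemma cube_countable_cover_volume (R : realType) (n : nat) (l : R)
    (I : choiceType) (m : I -> nat) (r : I -> R)
    (c : forall i, 'I_(m i) -> 'rV[R]_n) :
  0 < l -> (forall i, 0 < r i) ->
  (forall x, cube l x -> exists i k, box (c i k) (r i) x) ->
  exists2 s : seq I, uniq s &
    l ^+ n <= \sum_(i <- s) (m i)%:R * (4 * r i) ^+ n.
Proof.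
move=> l0 r0 cov.
have := @cube_compact R n l; rewrite compact_cover.
move=> /(_ I setT (fun i => \bigcup_k box (c i k) (r i)))[].
- by move=> i _; apply: bigcup_open => k _; exact: box_open.
- by move=> x /cov[i [k xk]]; exists i => //; exists k.
move=> D _ Dcov; exists (finmap.enum_fset D); first exact: finmap.fset_uniq.
apply: cube_cover_volume l0 r0 _ => x /Dcov[i iD [k _ xk]].
by exists i => //; exists k.
Qed.

(** The bound $N_d(E) < d^{-t}$, the form in which an upper box dimension below [t] is used at scale
    [d]. *)
Definition small_cover (R : realType) (n : nat) (E : set 'rV[R]_n) (t d : R) :=
  exists m : nat, exists V : 'I_m -> set 'rV[R]_n,
    [/\ m%:R < d `^ (- t), forall k, (diameter (V k) <= d%:E)%E &
        E `<=` \bigcup_k V k].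

Lemma difference_cover (R : realType) (n : nat) (U F : set 'rV[R]_n) (t d : R) :
  0 < d -> (diameter U <= d%:E)%E -> small_cover F t d ->
  exists m : nat, exists c : 'I_m -> 'rV[R]_n, m%:R < d `^ (- t) /\
    forall x y, U x -> F y -> exists k, box (c k) (3 * d) (x - y).
Proof.
move=> d0 Ud [m [V [md Vd FV]]].
have [c cP] := choice (fun k => difference_box d0 Ud (Vd k)).
exists m, c; split=> // x y Ux /FV[k _ Vy].
by exists k; exact: cP.
Qed.

(** The inequality behind both halves: index [i] contributes fewer than $d_i^{-t}$ boxes of radius
    $3 d_i$, each counted as $(4 \cdot 3 d_i)^n$, whence the factor [12 ^+ n]. *)
Lemma difference_cover_volume (R : realType) (n : nat) (l t : R)
    (I : choiceType) (U F : I -> set 'rV[R]_n) (d : I -> R) :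
  0 < l -> (forall i, 0 < d i) -> (forall i, (diameter (U i) <= (d i)%:E)%E) ->
  (forall i, small_cover (F i) t (d i)) ->
  (forall x, @cube R n l x -> exists i k a, [/\ U i k, F i a & x = k - a]) ->
  exists2 s : seq I, uniq s &
    l ^+ n <= 12 ^+ n * \sum_(i <- s) d i `^ (n%:R - t).
Proof.
move=> l0 d0 Ud Fd cov.
(* The type of the centres depends on their number, so the two are chosen together as a dependent
   pair. *)
have /choice[mc mcP] : forall i, exists mc : {m : nat & 'I_m -> 'rV[R]_n},
    (tag mc)%:R < d i `^ (- t) /\ forall x y, U i x -> F i y ->
      exists k, box (tagged mc k) (3 * d i) (x - y).
  move=> i; have [m [c mcP]] := difference_cover (d0 i) (Ud i) (Fd i).
  by exists (Tagged (fun m => 'I_m -> 'rV[R]_n) c).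
have [|x /cov[i [k [a [Uk Fa ->]]]]|s us ls] :=
  @cube_countable_cover_volume R n l I (fun i => tag (mc i)) (fun i => 3 * d i)
    (fun i => tagged (mc i)) l0.
- by move=> i; rewrite mulr_gt0.
- by exists i; exact: (mcP i).2.
exists s => //; apply: le_trans ls _.
rewrite mulr_sumr; apply: ler_sum => i _.
have -> : 4 * (3 * d i) = 12 * d i by ring.
rewrite exprMn mulrCA ler_pM2l ?exprn_gt0// addrC.
rewrite powRD ?(gt_eqF (d0 i)) ?implybT// (powR_mulrn _ (ltW (d0 i))).
by rewrite ler_pM2r ?exprn_gt0// ltW// (mcP i).1.
Qed.

(** * Box-counting dimensions *)

(** As [- ln d] is positive, the hypothesis compares the logarithms of $N_d(E)$ and $d^{-t}$; an
    infinite covering number would make the ratio infinite. *)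
Lemma box_ratio_small_cover (R : realType) (n : nat) (E : set 'rV[R]_n)
    (t d : R) :
  0 < d < 1 -> (box_ratio E d < t%:E)%E -> small_cover E t d.
Proof.
move=> d01; have ld : 0 < - ln d by rewrite oppr_gt0 ln_lt0.
have d0 : 0 < d by case/andP: d01.
rewrite /box_ratio => Et.
have : (covering_number d E < (d `^ (- t))%:E)%E.
  move: Et; case: covering_number => [r||]; last by rewrite ltNye.
  - rewrite lte_fin /=; case: (leP r 0) => [r0 _|r0].
      by rewrite (le_lt_trans r0)// powR_gt0.
    rewrite -EFinM lte_fin ltr_pdivrMr// => rt.
    by rewrite -ltr_ln ?posrE ?powR_gt0// ln_powR mulNr -mulrN.
  - by rewrite /= gt0_mulye ?lte_fin ?invr_gt0// ltNge leey.
move=> /ereal_inf_lt[_ [m [V [Vd EV]] <-]]; rewrite lte_fin => md.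
by exists m, V.
Qed.

Lemma upper_box_dim_small_cover (R : realType) (n : nat) (E : set 'rV[R]_n)
    (t : R) :
  (upper_box_dim E < t%:E)%E ->
  exists2 d0, 0 < d0 & forall d, 0 < d < d0 -> small_cover E t d.
Proof.
rewrite /upper_box_dim limf_esupE => /ereal_inf_lt[_ [V V0 <-] Vt].
(* The [1] keeps [- ln d] positive. *)
have [e /= e0 eV] := V0; exists (Num.min e 1); first by rewrite lt_min e0 ltr01.
move=> d /andP[d0]; rewrite lt_min => /andP[de d1].
apply: box_ratio_small_cover; first by rewrite d0.
apply: le_lt_trans Vt; apply: ereal_sup_ubound; exists d => //.
by apply: eV => //=; rewrite sub0r normrN gtr0_norm.
Qed.

Lemma powR_small (R : realType) (u e : R) : 0 < u -> 0 < e ->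
  exists2 d0, 0 < d0 & forall d, 0 < d < d0 -> d `^ u < e.
Proof.
move=> u0 e0; exists (e `^ u^-1); first exact: powR_gt0.
move=> d /andP[d0 de].
have -> : e = (e `^ u^-1) `^ u by rewrite -powRrM mulVf ?gt_eqF// powRr1// ltW.
by apply: gt0_ltr_powR => //; rewrite nnegrE ltW// powR_gt0.
Qed.

Lemma le_box_ratio (R : realType) (n : nat) (E : set 'rV[R]_n) (d w : R) :
  0 < d < 1 -> ((d `^ (- w))%:E <= covering_number d E)%E ->
  (w%:E <= box_ratio E d)%E.
Proof.
move=> d01 wE; have ld : 0 < - ln d by rewrite oppr_gt0 ln_lt0.
have d0 : 0 < d by case/andP: d01.
have -> : w%:E = (lne (d `^ (- w))%:E * ((- ln d)^-1)%:E)%E.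
  rewrite lne_EFin ?powR_gt0// ln_powR -EFinM; congr EFin.
  by field; rewrite lt_eqF// -oppr_gt0.
apply: lee_wpmul2r; first by rewrite lee_fin invr_ge0 ltW.
have p0 : (0 <= (d `^ (- w))%:E)%E by rewrite lee_fin powR_ge0.
by rewrite lee_lne// in_itv/= leey ?andbT// (le_trans p0).
Qed.

Lemma kakeya_lower_box_dim (R : realType) (n : nat) (K : set 'rV[R]_n) (s : R) :
  (0 < n)%N -> kakeya_set K -> (upper_box_dim (midpoints K) <= s%:E)%E ->
  ((n%:R - s)%:E <= lower_box_dim K)%E.
Proof.
move=> n0 kK As; apply/lee_addgt0Pr => e e0; rewrite -leeBlDr// -EFinB.
set l : R := 1 / (2 * n%:R).
have l0 : 0 < l by rewrite divr_gt0// mulr_gt0// ltr0n.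
(* The loss [e] is split: one half gives room above the box dimension of the midpoints, the other
   absorbs the constant [(l / 12) ^+ n] at small scales. *)
have [|d0 d00 Ad] := @upper_box_dim_small_cover R n (midpoints K) (s + e / 2).
  by rewrite (le_lt_trans As)// lte_fin ltrDl divr_gt0.
have [||d1 d10 d1P] := @powR_small R (e / 2) ((l / 12) ^+ n).
- by rewrite divr_gt0.
- by rewrite exprn_gt0// divr_gt0.
pose D := Num.min 1 (Num.min d0 d1).
have D0 : 0 < D by rewrite !lt_min ltr01 d00.
rewrite /lower_box_dim limf_einfE.
apply: (@le_trans _ _
    (ereal_inf [set box_ratio K d | d in [set d | 0 < d < D]])); last first.
  apply: ereal_sup_ubound; exists [set d | 0 < d < D] => //.
  exists D => //= d; rewrite /ball_/= sub0r normrN => dD d_gt0.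
  by rewrite d_gt0/= -[d]gtr0_norm.
apply: le_ereal_inf_tmp => _ [d /= /andP[d_gt0 +] <-].
rewrite !lt_min => /andP[d_lt1 /andP[dd0 dd1]].
apply: le_box_ratio; first by rewrite d_gt0.
apply: le_ereal_inf_tmp => _ [m [U [Ud KU]] <-]; rewrite lee_fin.
(* All scales equal [d], and every [U i] is paired with the same set of midpoints. *)
have [| | |x xc|S uS lS] := @difference_cover_volume R n l (s + e / 2) 'I_m
  U (fun=> midpoints K) (fun=> d) l0.
- by [].
- exact: Ud.
- by move=> _; apply: Ad; rewrite d_gt0.
- have [k [a [Kk Aa ->]]] := kakeya_cube n0 kK xc.
  by have [i _ Uk] := KU _ Kk; exists i, k, a.
(* [S] lists indices without repetition, so its sum has at most [m] equal terms. *)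
have Sm : (size S <= m)%N by rewrite -(card_uniqP uS) -[leqRHS]card_ord max_card.
move: lS; rewrite big_const_seq count_predT iter_addr_0 -[_ *+ size S]mulr_natl.
set P := d `^ (n%:R - (s + e / 2)).
have P0 : 0 < P by rewrite powR_gt0.
have dP : d `^ (- (n%:R - s - e)) = d `^ (e / 2) / P.
  by rewrite /P -powRN -powRD ?(gt_eqF d_gt0) ?implybT//; congr powR; lra.
rewrite dP ler_pdivrMr// => lS.
apply: le_trans (ltW (d1P d _)) _; first by rewrite d_gt0.
rewrite expr_div_n ler_pdivrMr ?exprn_gt0// mulrC; apply: le_trans lS _.
by rewrite ler_pM2l ?exprn_gt0// ler_pM2r// ler_nat.
Qed.

(** * Covers obtained from vanishing Hausdorff measure *)

Lemma diameter_ge0 (R : realType) (n : nat) (U : set 'rV[R]_n) :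
  (0 <= diameter U)%E.
Proof. by apply: ereal_sup_ubound; left. Qed.

Lemma diameter_set0 (R : realType) (n : nat) :
  diameter (set0 : set 'rV[R]_n) = 0%E.
Proof.
apply/eqP; rewrite eq_le diameter_ge0 andbT.
by apply: ge_ereal_sup => d [->|[x [y []]]].
Qed.

Lemma diameter_pow_ge0 (R : realType) (n : nat) (t : R) (U : set 'rV[R]_n) :
  (0 <= diameter_pow t U)%E.
Proof. by rewrite /diameter_pow; case: ifP => // _; exact: poweR_ge0. Qed.

(* A set of diameter 0 must be given a positive scale d, paid for by e. *)
Lemma diameter_pow_scale (R : realType) (n : nat) (t u r e : R)
    (U : set 'rV[R]_n) :
  t < u -> 0 < u -> 0 < r <= 1 -> 0 < e -> (diameter U <= (r / 2)%:E)%E ->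
  exists d, [/\ 0 < d < r, (diameter U <= d%:E)%E &
    ((d `^ u)%:E <= diameter_pow t U + e%:E)%E].
Proof.
move=> tu u0 /andP[r0 r1] e0 Ur.
have Ufin : diameter U \is a fin_num.
  by rewrite ge0_fin_numE ?diameter_ge0// (le_lt_trans Ur)// ltey.
have [U0|UN0] := eqVneq (diameter U) 0%E.
  have [d0 d00 dP] := powR_small u0 e0.
  pose d := Num.min d0 r / 2.
  have m0 : 0 < Num.min d0 r by rewrite lt_min d00.
  have [md mr] : Num.min d0 r <= d0 /\ Num.min d0 r <= r.
    by rewrite !ge_min !lexx orbT.
  exists d; split.
  - by apply/andP; split; rewrite /d; lra.
  - by rewrite U0 lee_fin /d; lra.
  - rewrite -[leLHS]add0e leeD ?diameter_pow_ge0// lee_fin ltW// dP//.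
    by apply/andP; split; rewrite /d; lra.
have [d Ud] : exists d, diameter U = d%:E by exists (fine (diameter U)); rewrite fineK.
rewrite Ud in Ur UN0 *; rewrite lee_fin in Ur.
have d0 : 0 < d.
  by rewrite lt_neqAle -(lee_fin 0) -Ud diameter_ge0 andbT eq_sym; exact: UN0.
exists d; split=> //; first by apply/andP; split => //; lra.
rewrite /diameter_pow ifF; last first.
  by apply: contraNF UN0 => /eqP U0; rewrite -Ud U0 diameter_set0.
rewrite Ud poweR_EFin -EFinD lee_fin (@le_trans _ _ (d `^ t))//; last first.
  by rewrite lerDl ltW.
by apply: ger_powR; [rewrite d0/=; lra|exact: ltW].
Qed.

Lemma sum_half_pow_le1 (R : realType) (Q : nat) :
  \sum_(j < Q) 2^-1 ^+ j.+1 <= 1 :> R.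
Proof.
suff -> : \sum_(j < Q) 2^-1 ^+ j.+1 = 1 - 2^-1 ^+ Q :> R.
  by rewrite lerBlDr lerDl exprn_ge0.
elim: Q => [|Q IH]; first by rewrite big_ord0 expr0 subrr.
by rewrite big_ord_recr/= IH exprS; field.
Qed.

(** Half of [e] bounds the sum of diameter powers; the other half pays for replacing diameters by
    positive scales. *)
Lemma hausdorff_null_cover (R : realType) (n : nat) (E : set 'rV[R]_n)
    (t u r e : R) :
  hausdorff_measure t E = 0%E -> t < u -> 0 < u -> 0 < r <= 1 -> 0 < e ->
  exists U : nat -> set 'rV[R]_n, exists d : nat -> R,
    [/\ forall j, 0 < d j < r, forall j, (diameter (U j) <= (d j)%:E)%E,
        E `<=` \bigcup_j U j & forall Q, \sum_(j < Q) d j `^ u <= e].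
Proof.
move=> Et tu u0 r01 e0; have /andP[r0 r1] := r01.
(* Diameters up to [r / 2] leave room for scales strictly below [r]. *)
have : (hausdorff_premeasure t (r / 2) E < (e / 2)%:E)%E.
  apply: (@le_lt_trans _ _ 0%E); last by rewrite lte_fin divr_gt0.
  by rewrite -Et; apply: ereal_sup_ubound; exists (r / 2) => //=; rewrite divr_gt0.
move=> /ereal_inf_lt[_ [U [Ur EU] <-] Ue].
(* The allowances shrink geometrically, so that all of them together cost at most [e / 2]. *)
have e2 j : 0 < e / 2 * 2^-1 ^+ j.+1 by rewrite !mulr_gt0// exprn_gt0.
have [d dP] := choice (fun j => diameter_pow_scale tu u0 r01 (e2 j) (Ur j)).
exists U, d; split=> // [j|j|Q]; [by case: (dP j)..|].
rewrite -lee_fin -sumEFin.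
apply: (@le_trans _ _
  (\sum_(j < Q) (diameter_pow t (U j) + (e / 2 * 2^-1 ^+ j.+1)%:E))%E).
  by apply: lee_sum => j _; case: (dP j).
rewrite big_split/= sumEFin -mulr_sumr.
rewrite [in leRHS](_ : e = e / 2 + e / 2); last by field.
rewrite EFinD leeD//.
  apply: le_trans (ltW Ue).
  rewrite -(big_mkord xpredT (fun j => diameter_pow t (U j))).
  by apply: nneseries_lim_ge => j _ _; exact: diameter_pow_ge0.
by rewrite lee_fin ler_piMr ?divr_ge0 ?sum_half_pow_le1 ?ltW.
Qed.

Lemma ler_sum_subseq (R : numDomainType) (I : eqType) (s s' : seq I)
    (w : I -> R) :
  uniq s -> uniq s' -> {subset s <= s'} -> (forall i, 0 <= w i) ->
  \sum_(i <- s) w i <= \sum_(i <- s') w i.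
Proof.
move=> us us' ss' w0; rewrite [leRHS](bigID (mem s))/= -[X in X + _]big_filter.
have ss'P : perm_eq [seq i <- s' | i \in s] s.
  apply: uniq_perm; rewrite ?filter_uniq// => i.
  by rewrite mem_filter; case: (boolP (i \in s)) => // /ss'.
by rewrite (perm_big _ ss'P) lerDl sumr_ge0.
Qed.

(** A finite list of pairs fits into a square of side [N], whose row sums are dominated by a
    geometric series. *)
Lemma sum_pairs_le (R : realType) (s : seq (nat * nat)) (w : nat * nat -> R)
    (e : R) :
  uniq s -> (forall p, 0 <= w p) -> 0 <= e ->
  (forall i Q, \sum_(j < Q) w (i, val j) <= e * 2^-1 ^+ i.+1) ->
  \sum_(p <- s) w p <= e.
Proof.
move=> us w0 e0 we.
pose N := (\max_(p <- s) maxn p.1 p.2).+1.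
apply: (@le_trans _ _ (\sum_(p <- [seq (i, j) | i <- index_iota 0 N, j <- index_iota 0 N]) w p)).
  apply: ler_sum_subseq => //.
    by apply: allpairs_uniq; rewrite ?iota_uniq// => -[? ?] [? ?].
  move=> [i j] ps; have : (maxn i j < N)%N by rewrite ltnS; exact: leq_bigmax_seq ps _.
  by rewrite gtn_max => /andP[iN jN]; apply/allpairsP; exists (i, j); rewrite !mem_index_iota.
rewrite big_allpairs.
apply: (@le_trans _ _ (\sum_(i < N) e * 2^-1 ^+ i.+1)).
  rewrite big_mkord; apply: ler_sum => i _.
  by rewrite big_mkord.
by rewrite -mulr_sumr ler_piMr// sum_half_pow_le1.
Qed.

(** * Hausdorff dimension of K *)

Lemma kakeya_hausdorff_dim (R : realType) (n : nat) (K : set 'rV[R]_n) (s : R) :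
  (0 < n)%N -> kakeya_set K -> (packing_dim (midpoints K) <= s%:E)%E ->
  ((n%:R - s)%:E <= hausdorff_dim K)%E.
Proof.
move=> n0 kK As.
apply: le_ereal_inf_tmp => _ [t [t0 Kt] <-].
rewrite lee_fin leNgt; apply/negP => ts.
(* The midpoint of [s] and [n - t]: above the packing dimension, yet with [n - s'] still above [t],
   where K has measure 0. *)
pose s' := (s + (n%:R - t)) / 2.
have ss' : s < s' by rewrite /s'; lra.
have tu : t < n%:R - s' by rewrite /s'; lra.
have u0 : 0 < n%:R - s' by exact: le_lt_trans tu.
have : (packing_dim (midpoints K) < s'%:E)%E by rewrite (le_lt_trans As)// lte_fin.
move=> /ereal_inf_lt[_ [F [_ AF] <-] Fs].
set l : R := 1 / (2 * n%:R).
have l0 : 0 < l by rewrite divr_gt0// mulr_gt0// ltr0n.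
(* Half the total that [difference_cover_volume] forces on the sum, hence a contradiction at the
   end. *)
pose e := (l / 12) ^+ n / 2.
have e0 : 0 < e by rewrite divr_gt0// exprn_gt0// divr_gt0.
have /choice[r rP] : forall i, exists r, 0 < r <= 1 /\
    forall d, 0 < d < r -> small_cover (F i) s' d.
  move=> i; have [|d0 d00 dP] := @upper_box_dim_small_cover R n (F i) s'.
    by apply: le_lt_trans Fs; apply: ereal_sup_ubound; exists i.
  exists (Num.min d0 1); rewrite lt_min d00 ltr01 ge_min lexx orbT; split=> // d.
  by rewrite lt_min => /andP[d_gt0 /andP[dd0 _]]; apply: dP; rewrite d_gt0.
have ei i : 0 < e * 2^-1 ^+ i.+1 by rewrite mulr_gt0// exprn_gt0.
(* K is covered anew for each piece [F i], at scales below the threshold [r i] of that piece and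
   within the budget [e * 2^-1 ^+ i.+1]. *)
have [U UP] := choice (fun i => hausdorff_null_cover Kt tu u0 (rP i).1 (ei i)).
have [d dP] := choice UP.
(* In a pair [(i, j)], [i] is the piece containing the midpoint and [j] the set of the [i]-th cover
   of K containing the other point. *)
have [| | |x xc|S uS] := @difference_cover_volume R n l s' (nat * nat)%type
  (fun p => U p.1 p.2) (fun p => F p.1) (fun p => d p.1 p.2) l0.
- by move=> [i j] /=; have [/(_ j)/andP[]] := dP i.
- by move=> [i j] /=; have [_ /(_ j)] := dP i.
- by move=> [i j] /=; apply: (rP i).2; have [/(_ j)] := dP i.
- have [k [a [Kk Aa ->]]] := kakeya_cube n0 kK xc.
  have [i _ Fa] := AF _ Aa; have [_ _ KU _] := dP i.
  by have [j _ Uk] := KU _ Kk; exists (i, j), k, a.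
apply/negP; rewrite -ltNge -ltr_pdivlMl ?exprn_gt0//.
apply: (@le_lt_trans _ _ e); last first.
  rewrite /e expr_div_n mulrC.
  have : 0 < (12 ^+ n)^-1 * l ^+ n by rewrite mulr_gt0// ?invr_gt0 exprn_gt0.
  by rewrite [l ^+ n / _]mulrC; lra.
apply: sum_pairs_le => // [p||i Q]; [exact: powR_ge0|exact: ltW|].
by have [_ _ _ /(_ Q)] := dP i.
Qed.

Theorem propositionA (R : realType) (n : nat) (hn : (2 <= n)%N)
  (K : set 'rV[R]_n) (hK : kakeya_set K) (s : R) :
  ((upper_box_dim (midpoints K) <= s%:E)%E ->
     ((n%:R - s)%:E <= lower_box_dim K)%E) /\
  ((packing_dim (midpoints K) <= s%:E)%E ->
     ((n%:R - s)%:E <= hausdorff_dim K)%E).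
Proof.
have n0 : (0 < n)%N by exact: ltnW.
by split=> [As|As]; [exact: kakeya_lower_box_dim|exact: kakeya_hausdorff_dim].
Qed.
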